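(* Let $k,D\ge1$ and $q\in(0,1)$. There exists a 2-layer Transformer $\mathcal T$ (as defined in the context) with uniform attention in both layers, with no positional embedding, with causal mask and a starting token, that generates the (depth-bounded) Dyck language of arbitrary length; that is, for every $n\ge 0$ and every $w_{1:n}\in\mathrm{Dyck}_{k,D,n}$, the output $\mathcal T(w_{1:n})\in\mathbb R^{2k}$ equals the true next-token probability vector given $w_{1:n}$ under the distributions $\mathcal D_{q,k,D,N}$, $N>n$.
   Context: **Dyck languages.** The alphabet is $[2k]=\{1,\dots,2k\}$; for $t\in[k]$, tokens $2t-1$ and $2t$ are the matching open and closed brackets of type $t$. $\mathrm{Dyck}_k$ is the set of well-balanced strings. $\mathrm{depth}(w_{1:i})$ is the number of open minus the number of closed brackets in $w_{1:i}$. $\mathrm{Dyck}_{k,D}$ is the set of words of $\mathrm{Dyck}_k$ all of whose prefixes have depth $\le D$, and $\mathrm{Dyck}_{k,D,N}$ is the set of length-$N$ prefixes of words of $\mathrm{Dyck}_{k,D}$. **Distribution.** $\mathcal D_{q,k,D,N}$ is the distribution on $\mathrm{Dyck}_{k,D,N}$ with $\mathbb P(w_{1:N})\propto (1/k)^{\#\{i:\,w_i\text{ open},\,\mathrm{depth}(w_{1:i})=1\}}\,(q/k)^{\#\{i:\,w_i\text{ open},\,\mathrm{depth}(w_{1:i})>1\}}\,(1-q)^{\#\{i:\,w_i\text{ closed},\,\mathrm{depth}(w_{1:i})<D-1\}}$. Thus the next-token law depends only on the prefix: at depth $0$ the next token is a uniformly random open bracket; at depth $D$ it is the unique valid closed bracket;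 otherwise it is each open bracket with probability $q/k$ and the unique valid closed bracket with probability $1-q$. **Architecture.** A starting token $t_{\mathcal S}$, distinct from all tokens of the language, is prepended to the input; the resulting $n+1$ tokens are one-hot encoded as the columns of $Z\in\mathbb R^{(2k+1)\times(n+1)}$. With a word embedding matrix $W_E\in\mathbb R^{m\times(2k+1)}$ and a linear head $W_{\mathrm{Head}}$ with $2k$ rows, $\mathcal T(w_{1:n})=W_{\mathrm{Head}}\,[f_2(f_1(W_EZ))]_{:,n+1}$, where layer $l\in\{1,2\}$ acts on a matrix $X$ by $$f_l(X)=g^{(l)}\Big(\mathrm{LN}\big(W_V^{(l)}X\,\sigma(\mathcal C+(W_K^{(l)}X)^\top(W_Q^{(l)}X))\big)+X\Big).$$ Here $g^{(l)}$ is a ReLU MLP applied to each column, $\sigma$ is the column-wise softmax, $\mathcal C_{i,j}=-\infty$ if $i>j$ and $0$ otherwise (causal mask), and LN acts on each column $a$ as $\mathcal P_\bot a/\|\mathcal P_\bot a\|_2$ (and $0$ if $\mathcal P_\bot a=0$), with $\mathcal P_\bot=I-\frac1m\mathbf 1\mathbf 1^\top$. Uniform attention means that in each layer the attention matrix $\sigma(\cdot)$ has, in column $j$, all entries $i\le j$ equal to $1/j$ (e.g. $W_K^{(l)}=W_Q^{(l)}=0$). The dimensions and widths may be chosen freely, but do not depend on $n$. *)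

(* Defs.v *)
From HB Require Import structures.
From mathcomp Require Import all_boot all_order all_algebra.
From mathcomp Require Import boolp reals ereal exp.

Set Implicit Arguments.
Unset Strict Implicit.
Unset Printing Implicit Defensive.
Import Order.TTheory GRing.Theory Num.Theory.
Local Open Scope ring_scope.

(** * Bounded-depth Dyck languages *)

Section Dyck.
Variable k : nat.

(* Tokens are numbered from 0: for t < k, the tokens 2t and 2t+1 are the open
   and closed brackets of type t. *)
Notation token := 'I_(2 * k).

Lemma open_subproof (t : 'I_k) : (2 * t < 2 * k)%N.
Proof. by rewrite ltn_pmul2l. Qed.

Lemma close_subproof (t : 'I_k) : ((2 * t).+1 < 2 * k)%N.
Proof. by rewrite (@leq_trans (2 * t.+1)) ?leq_pmul2l // mulnS. Qed.

Definition open_br (t : 'I_k) : token := Ordinal (open_subproof t).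
Definition close_br (t : 'I_k) : token := Ordinal (close_subproof t).

Definition is_open (a : token) : bool := ~~ odd a.
Definition is_closed (a : token) : bool := odd a.

Inductive balanced : seq token -> Prop :=
| balanced_nil : balanced [::]
| balanced_wrap t u : balanced u -> balanced (open_br t :: rcons u (close_br t))
| balanced_cat u v : balanced u -> balanced v -> balanced (u ++ v).

Definition depth (w : seq token) : int :=
  (count is_open w)%:Z - (count is_closed w)%:Z.

Definition Dyck (D : nat) (w : seq token) : Prop :=
  balanced w /\ forall i, depth (take i w) <= D%:Z.

Definition Dyck_prefix (D N : nat) (w : N.-tuple token) : Prop :=
  exists v : seq token, Dyck D (w ++ v).

End Dyck.

(** * The distribution on length-[N] prefixes *)

Section Distribution.
Variables (R : realType) (k : nat) (q : R) (D : nat).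
Notation token := 'I_(2 * k).

(* The position i : 'I_N is 0-based, so [take i.+1 w] is the prefix that ends
   with the token at that position. *)
Definition Dyck_weight N (w : N.-tuple token) : R :=
  (1 / k%:R) ^+ #|[set i : 'I_N | is_open (tnth w i)
                                 & depth (take i.+1 w) == 1]|
  * (q / k%:R) ^+ #|[set i : 'I_N | is_open (tnth w i)
                                   & 1 < depth (take i.+1 w)]|
  * (1 - q) ^+ #|[set i : 'I_N | is_closed (tnth w i)
                                & depth (take i.+1 w) < D%:Z - 1]|.

Definition Dyck_pmf N (w : N.-tuple token) : R :=
  if `[< Dyck_prefix D w >] then
    Dyck_weight w / \sum_(v : N.-tuple token | `[< Dyck_prefix D v >])
                      Dyck_weight v
  else 0.

Definition Dyck_prob N (A : pred (N.-tuple token)) : R :=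
  \sum_(w : N.-tuple token | A w) Dyck_pmf w.

(* The entry a is the conditional probability, for a random word x of length N,
   that x starts with [rcons u a] given that x starts with u; this is meant for
   [size u < N]. *)
Definition next_token_prob N (u : seq token) : 'cV[R]_(2 * k) :=
  \col_a (Dyck_prob (fun x : N.-tuple token => prefix (rcons u a) x)
          / Dyck_prob (fun x : N.-tuple token => prefix u x)).

End Distribution.

(** * Two-layer Transformers *)

Section Columnwise.
Variable R : realType.

Definition map_cols m p N (f : 'cV[R]_m -> 'cV[R]_p) (X : 'M[R]_(m, N)) :
    'M[R]_(p, N) :=
  \matrix_(i, j) f (col j X) i 0.

Definition causal_mask N : 'M[\bar R]_N :=
  \matrix_(i, j) if (j < i)%N then -oo%E else 0%E.

Definition softmax_cols N (A : 'M[\bar R]_N) : 'M[R]_N :=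
  \matrix_(i, j) (fine (expeR (A i j)) / \sum_(l < N) fine (expeR (A l j))).

Definition proj_perp m : 'M[R]_m := 1%:M - (m%:R^-1 *: const_mx 1).

Definition norm2 m (a : 'cV[R]_m) : R := Num.sqrt (\sum_i a i 0 ^+ 2).

Definition layer_norm m (a : 'cV[R]_m) : 'cV[R]_m :=
  let b := proj_perp m *m a in
  if b == 0 then 0 else (norm2 b)^-1 *: b.

Definition relu m (x : 'cV[R]_m) : 'cV[R]_m := map_mx (Num.max 0) x.

(* ReLU multilayer perceptrons with biases, of arbitrary depth and widths; no
   ReLU is applied after the last affine map. *)
Inductive mlp : nat -> nat -> Type :=
| MlpAffine m p (A : 'M[R]_(p, m)) (b : 'cV[R]_p) : mlp m p
| MlpHidden m h p (A : 'M[R]_(h, m)) (b : 'cV[R]_h) (g : mlp h p) : mlp m p.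

Fixpoint mlp_eval m p (g : mlp m p) : 'cV[R]_m -> 'cV[R]_p :=
  match g with
  | MlpAffine _ _ A b => fun x => A *m x + b
  | MlpHidden _ _ _ A b g' => fun x => mlp_eval g' (relu (A *m x + b))
  end.

End Columnwise.

Record layer (R : realType) (m : nat) := Layer {
  attn_dim : nat;
  W_K : 'M[R]_(attn_dim, m);
  W_Q : 'M[R]_(attn_dim, m);
  W_V : 'M[R]_m;
  layer_mlp : mlp R m m
}.

Section Layer.
Variables (R : realType) (m : nat) (L : layer R m).

Definition attention N (X : 'M[R]_(m, N)) : 'M[R]_N :=
  let S := (W_K L *m X)^T *m (W_Q L *m X) in
  softmax_cols (\matrix_(i, j) (causal_mask R N i j + (S i j)%:E)%E).

Definition layer_eval N (X : 'M[R]_(m, N)) : 'M[R]_(m, N) :=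
  map_cols (mlp_eval (layer_mlp L))
    (map_cols (@layer_norm R m) (W_V L *m X *m attention X) + X).

(* Column j, counted from 0, attends to j.+1 positions. *)
Definition uniform_attention : Prop :=
  forall N (X : 'M[R]_(m, N)) (i j : 'I_N),
    (i <= j)%N -> attention X i j = j.+1%:R^-1.

End Layer.

Record transformer2 (R : realType) (k : nat) := Transformer2 {
  model_dim : nat;
  W_E : 'M[R]_(model_dim, (2 * k).+1);
  layer1 : layer R model_dim;
  layer2 : layer R model_dim;
  W_Head : 'M[R]_(2 * k, model_dim)
}.

Section Transformer.
Variables (R : realType) (k : nat).

(* The starting token is the last element of 'I_(2 * k).+1; the tokens of the
   language keep their numbers. *)
Definition with_start n (w : n.-tuple 'I_(2 * k)) :
    n.+1.-tuple 'I_(2 * k).+1 :=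
  [tuple of ord_max :: map_tuple (widen_ord (leqnSn (2 * k))) w].

Definition one_hot n (w : n.-tuple 'I_(2 * k)) : 'M[R]_((2 * k).+1, n.+1) :=
  \matrix_(i, j) (i == tnth (with_start w) j)%:R.

Definition transformer2_eval (T : transformer2 R k) n
    (w : n.-tuple 'I_(2 * k)) : 'cV[R]_(2 * k) :=
  W_Head T *m
    col ord_max (layer_eval (layer2 T) (layer_eval (layer1 T)
                   (W_E T *m one_hot w))).

End Transformer.

(* Main.v *)
(** Encode an open bracket of type t by +v_t, the matching closed bracket by
    -v_t and the starting token by a separate unit vector e. The sum of the
    codes over a prefix is then e plus the codes of the unmatched brackets,
    which takes finitely many values because the depth is at most D. Uniform
    attention computes this sum up to a positive factor that depends on the
    position; the layer normalization removes it, and the coordinate of e, which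
    is 1 before normalization, makes the sum recoverable. Layer 1 thus finds the
    depth of each position, and its MLP refines the code v_t to a code v_(t,i)
    that also carries the level i of the bracket in the stack. The prefix sums
    of layer 2 then determine the whole stack, hence the next-token law. Both
    MLPs only have to be correct on finitely many points, so they exist by
    interpolation. *)

Require Import Defs.
From mathcomp Require Import all_boot all_order all_algebra.
From mathcomp Require Import boolp reals ereal exp.
From mathcomp Require Import ring zify.
Set Implicit Arguments.
Unset Strict Implicit.
Unset Printing Implicit Defensive.
Import Order.TTheory GRing.Theory Num.Theory.
Local Open Scope ring_scope.

(** * ReLU interpolation on finite families *)

Section Interpolation.
Variables (R : realType) (I : finType) (m p : nat).
Variables (x : I -> 'cV[R]_m) (z : I -> 'cV[R]_p).

Let dist1 (a b : 'cV[R]_m) : R := \sum_c `|a c 0 - b c 0|.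

(** The sum dominates the inverse of each nonzero distance; zero distances contribute [0], the
    inverse of [0] being [0]. *)
Let bump_slope : R := \sum_i \sum_l (dist1 (x i) (x l))^-1.

Let dist1_ge0 a b : 0 <= dist1 a b. Proof. by apply: sumr_ge0. Qed.

Let dist1_eq0 a b : (dist1 a b == 0) = (a == b).
Proof.
apply/idP/eqP=> [|->]; last by rewrite /dist1 big1 // => c _; rewrite subrr normr0.
rewrite psumr_eq0 // => /allP h; apply/colP => c.
have /h := mem_index_enum c; rewrite implyTb normr_eq0 subr_eq0 => /eqP //.
Qed.

Let bump_slopeP i l : x i != x l -> 1 <= bump_slope * dist1 (x i) (x l).
Proof.
move=> ne; have d0 : dist1 (x i) (x l) != 0 by rewrite dist1_eq0.
have dp : 0 < dist1 (x i) (x l) by rewrite lt_neqAle eq_sym d0 dist1_ge0.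
rewrite -ler_pdivrMr // mul1r /bump_slope (bigD1 i) //= (bigD1 l) //= -addrA.
rewrite lerDl addr_ge0 //; last apply: sumr_ge0 => ? _;
  by apply: sumr_ge0 => ? _; rewrite invr_ge0.
Qed.

Let bump i a : R := Num.max 0 (1 - bump_slope * dist1 a (x i)).

Let bumpE i l : bump i (x l) = (x i == x l)%:R.
Proof.
rewrite /bump; have [->|/eqP ne] := x i =P x l.
  have /eqP -> : dist1 (x l) (x l) == 0 by rewrite dist1_eq0.
  by rewrite mulr0 subr0 max_r.
by rewrite max_l // subr_le0 bump_slopeP // eq_sym.
Qed.

(** One hidden neuron for each centre, coordinate and sign: two rectified neurons of opposite sign
    add up to an absolute value, as [dist1] requires. *)
Let coordT := (I * 'I_m * bool)%type.
Let sgn (b : bool) : R := if b then -1 else 1.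

Let hidden1 : 'M[R]_(#|{: coordT}|, m) :=
  \matrix_(r, c) let: (i, c', b) := enum_val r in sgn b * (c' == c)%:R.
Let bias1 : 'cV[R]_#|{: coordT}| :=
  \col_r let: (i, c, b) := enum_val r in - sgn b * x i c 0.
Let hidden2 : 'M[R]_(#|I|, #|{: coordT}|) :=
  \matrix_(r, s) let: (i, c, b) := enum_val s in
                 - bump_slope * (i == enum_val r)%:R.

Let hidden1E a i c b :
  (hidden1 *m a + bias1) (enum_rank (i, c, b)) 0 = sgn b * (a c 0 - x i c 0).
Proof.
rewrite !mxE enum_rankK mulrBr mulNr; congr (_ - _).
under eq_bigr => j _ do rewrite !mxE enum_rankK.
rewrite (bigD1 c) //= eqxx mulr1 big1 ?addr0 // => j jc.
by rewrite eq_sym (negbTE jc) mulr0 mul0r.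
Qed.

Let relu_abs (r : R) : Num.max 0 r + Num.max 0 (- r) = `|r|.
Proof.
case/orP: (le_total 0 r) => h.
  by rewrite ger0_norm // max_r // max_l ?addr0 // oppr_le0.
by rewrite ler0_norm // max_l // max_r ?add0r // oppr_ge0.
Qed.

Let hidden2E a r :
  relu (hidden2 *m relu (hidden1 *m a + bias1) + const_mx 1) r 0 =
  bump (enum_val r) a.
Proof.
rewrite !mxE addrC /bump; congr (Num.max _ (_ + _)).
rewrite (reindex enum_rank) /=; last by apply: onW_bij; apply: enum_rank_bij.
transitivity (\sum_(t : coordT) - bump_slope * (t.1.1 == enum_val r)%:R *
    Num.max 0 (sgn t.2 * (a t.1.2 0 - x t.1.1 t.1.2 0))).
  by apply: eq_bigr => -[[i c] b] _; rewrite mxE enum_rankK mxE hidden1E.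
rewrite -(pair_bigA _ (fun ic b => - bump_slope * (ic.1 == enum_val r)%:R *
    Num.max 0 (sgn b * (a ic.2 0 - x ic.1 ic.2 0)))) /=.
rewrite -(pair_bigA _ (fun i c => \sum_b - bump_slope * (i == enum_val r)%:R *
    Num.max 0 (sgn b * (a c 0 - x i c 0)))) /=.
rewrite (bigD1 (enum_val r)) //= [X in _ + X]big1 ?addr0 => [|i ne]; last first.
  by rewrite big1 // => c _; rewrite big1 // => b _; rewrite (negbTE ne) mulr0 mul0r.
rewrite eqxx mulr1 /dist1 -mulNr mulr_sumr; apply: eq_bigr => c _.
by rewrite big_bool /= mulN1r mul1r -mulrDr addrC relu_abs.
Qed.

Lemma mlp_interpolation :
  (forall i j, x i = x j -> z i = z j) ->
  exists g : mlp R m p, forall i, mlp_eval g (x i) = z i.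
Proof.
(* The bump of each point vanishes at all the other points; dividing by mult
   compensates for repetitions in the family. *)
move=> cons; pose mult i : R := \sum_l (x l == x i)%:R.
exists (MlpHidden hidden1 bias1 (MlpHidden hidden2 (const_mx 1)
  (MlpAffine (\matrix_(r, s) (z (enum_val s) r 0 / mult (enum_val s))) 0))) => l /=.
rewrite addr0; apply/colP => r; rewrite mxE.
under eq_bigr => s _ do rewrite mxE hidden2E bumpE.
rewrite (reindex enum_rank) /=; last by apply: onW_bij; apply: enum_rank_bij.
have mult_neq0 : mult l != 0.
  rewrite gt_eqF // /mult (bigD1 l) //= eqxx ltr_pwDl ?ltr01 // sumr_ge0 // => *.
transitivity (\sum_i (z l r 0 / mult l) * (x i == x l)%:R).
  apply: eq_bigr => i _; rewrite enum_rankK.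
  have [e|_] := eqVneq (x i) (x l); last by rewrite !mulr0.
  by rewrite (cons _ _ e) /mult e.
by rewrite -mulr_sumr divfK.
Qed.

End Interpolation.

(** * Layers with uniform attention *)

Section UniformLayer.
Variables (R : realType) (m : nat) (V : 'M[R]_m) (g : mlp R m m).

(** With key and query dimension [0] all scores are empty sums, so the softmax sees only the causal
    mask. *)
Definition uniform_layer : layer R m := @Layer R m 0 0 0 V g.

Lemma attention_uniform_layer N (X : 'M[R]_(m, N)) (i j : 'I_N) :
  attention uniform_layer X i j = if (j < i)%N then 0 else j.+1%:R^-1.
Proof.
have maskE (l : 'I_N) : fine (expeR (causal_mask R N l j +
    (((W_K uniform_layer *m X)^T *m (W_Q uniform_layer *m X)) l j)%:E)) =
    (l <= j)%:R.
  rewrite !mxE big1 => [|c _]; last by rewrite !mul0mx !mxE mul0r.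
  by rewrite adde0; case: ltnP => h; rewrite /= ?expR0.
rewrite mxE; under eq_bigr => l _ do rewrite mxE maskE.
rewrite mxE maskE -natr_sum ltnNge.
have -> : (\sum_(l < N) (l <= j))%N = j.+1.
  rewrite -[RHS]card_ord -sum1_card (big_ord_widen N (fun=> 1%N)) ?ltn_ord //.
  by rewrite [RHS]big_mkcond; apply: eq_bigr => l _; rewrite ltnS; case: leqP.
by case: leqP => _ /=; rewrite ?mul1r ?mul0r.
Qed.

Lemma uniform_attention_layer : uniform_attention uniform_layer.
Proof. by move=> N X i j ij; rewrite attention_uniform_layer ltnNge ij. Qed.

Lemma col_layer_eval N (X : 'M[R]_(m, N)) (j : 'I_N) :
  col j (layer_eval uniform_layer X) =
  mlp_eval g (layer_norm (V *m (j.+1%:R^-1 *: \sum_(i < N | (i <= j)%N) col i X))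
              + col j X).
Proof.
have colV : col j (V *m X *m attention uniform_layer X) =
    V *m (j.+1%:R^-1 *: \sum_(i < N | (i <= j)%N) col i X); last first.
  apply/colP => r; rewrite mxE [LHS]mxE -colV; congr (mlp_eval _ _ _ _).
  by apply/colP => c; rewrite ![LHS]mxE [RHS]mxE; congr (_ + _); rewrite mxE.
rewrite colE -!mulmxA -colE; congr (_ *m _).
apply/colP => d; rewrite !mxE summxE mulr_sumr [RHS]big_mkcond.
apply: eq_bigr => i _; rewrite mxE attention_uniform_layer ltnNge.
by case: leqP => _ /=; rewrite ?mulr0 // mxE mulrC.
Qed.

End UniformLayer.

(** * Layer normalization of scaled and of centered vectors *)

Section LayerNorm.
Variable R : realType.

Lemma norm2Z m (r : R) (a : 'cV[R]_m) : norm2 (r *: a) = `|r| * norm2 a.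
Proof.
rewrite /norm2; under eq_bigr => i _ do rewrite mxE exprMn.
by rewrite -mulr_sumr sqrtrM ?sqr_ge0 // sqrtr_sqr.
Qed.

Lemma norm2_eq0 m (a : 'cV[R]_m) : (norm2 a == 0) = (a == 0).
Proof.
rewrite sqrtr_eq0; apply/idP/eqP => [|->]; last first.
  by rewrite big1 // => i _; rewrite mxE expr0n.
move=> h; have : \sum_i a i 0 ^+ 2 == 0.
  by rewrite eq_le h sumr_ge0 // => i _; rewrite sqr_ge0.
rewrite psumr_eq0 => [/allP s|i _]; last exact: sqr_ge0.
apply/colP => c; have /s := mem_index_enum c.
by rewrite implyTb sqrf_eq0 => /eqP ->; rewrite mxE.
Qed.

(** This removes the averaging factor of uniform attention, which varies with the position. *)
Lemma layer_normZ m (r : R) (a : 'cV[R]_m) :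
  0 < r -> layer_norm (r *: a) = layer_norm a.
Proof.
move=> r0; rewrite /layer_norm -scalemxAr scaler_eq0 gt_eqF //=.
case: eqP => // _; rewrite norm2Z gtr0_norm // scalerA invfM mulrAC mulVf ?mul1r //.
by rewrite gt_eqF.
Qed.

Lemma layer_norm_centered m (a : 'cV[R]_m) :
  \sum_i a i 0 = 0 -> layer_norm a = (norm2 a)^-1 *: a.
Proof.
move=> a0; rewrite /layer_norm.
have -> : proj_perp R m *m a = a.
  rewrite mulmxBl mul1mx -scalemxAl.
  suff -> : const_mx 1 *m a = 0 :> 'cV[R]_m by rewrite scaler0 subr0.
  apply/colP => c; rewrite !mxE -[RHS]a0; apply: eq_bigr => i _.
  by rewrite mxE mul1r.
by case: eqP => // ->; rewrite scaler0.
Qed.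

End LayerNorm.

(** * Layers that read off prefix sums *)

Section PrefixSumLayer.
Variables (R : realType) (c : nat) (I : finType) (o : 'I_c).
Variables (y u : I -> 'cV[R]_c) (z : I -> 'cV[R]_(c + (c + c))).
Hypothesis u_o : forall i, u i o 0 = 1.
Hypothesis y_u_determine_z : forall i j, y i = y j -> u i = u j -> z i = z j.

(** Pairing [a] with [- a] makes the entries sum to [0], so layer normalization only rescales; the
    zero block leaves room for the residual [y]. *)
Let center (a : 'cV[R]_c) : 'cV[R]_(c + (c + c)) := col_mx 0 (col_mx a (- a)).

Let W : 'M[R]_(c + (c + c)) := block_mx 0 0 (col_mx 1%:M (- 1%:M)) 0.

Let mulW a : W *m col_mx a 0 = center a.
Proof.
by rewrite mul_block_col !mul0mx add0r addr0 mul_col_mx mulNmx mul1mx.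
Qed.

Let sum_center a : \sum_i center a i 0 = 0.
Proof.
rewrite /center !big_split_ord /= big1 ?add0r => [|i _]; last by rewrite col_mxEu mxE.
rewrite -big_split big1 //= => i _.
by rewrite !col_mxEd col_mxEu mxE subrr.
Qed.

(** The MLP receives [y] and a positive multiple of [u]. Coordinate [o] of [u] being [1], that
    multiple is visible and [u] can be recovered, so [z] is a function of the MLP input on the
    finite index set. *)
Lemma prefix_sum_layer : exists L : layer R (c + (c + c)),
  uniform_attention L /\
  forall N (X : 'M[R]_(c + (c + c), N)) (idx : 'I_N -> I),
    (forall j : 'I_N, col j X = col_mx (y (idx j)) 0) ->
    (forall j : 'I_N, \sum_(i < N | (i <= j)%N) y (idx i) = u (idx j)) ->
  forall j : 'I_N, col j (layer_eval L X) = z (idx j).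
Proof.
pose x i := layer_norm (center (u i)) + col_mx (y i) 0.
have xE i : x i = col_mx (y i) ((norm2 (center (u i)))^-1 *: col_mx (u i) (- u i)).
  by rewrite /x layer_norm_centered // scale_col_mx scaler0 add_col_mx add0r addr0.
have nrm_neq0 i : (norm2 (center (u i)))^-1 != 0.
  rewrite invr_eq0 norm2_eq0; apply/eqP => /(congr1 (fun a => usubmx (dsubmx a) o 0)).
  by rewrite col_mxKd col_mxKu u_o !mxE; apply/eqP; rewrite oner_eq0.
have [|g gx] := @mlp_interpolation R I _ _ x z.
  move=> i j; rewrite !xE => /eq_col_mx[ey]; rewrite !scale_col_mx => /eq_col_mx[eu _].
  apply: y_u_determine_z => //.
  have := congr1 (fun a : 'cV_c => a o 0) eu; rewrite !mxE !u_o !mulr1 => en.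
  by move: eu; rewrite en => /(scalerI (nrm_neq0 j)).
exists (uniform_layer W g); split; first exact: uniform_attention_layer.
move=> N X idx Xy Su j; rewrite col_layer_eval Xy -scalemxAr.
rewrite layer_normZ ?invr_gt0 ?ltr0n //.
suff -> : \sum_(i < N | (i <= j)%N) col i X = col_mx (u (idx j)) 0.
  by rewrite mulW gx.
rewrite -Su; apply/colP => r; rewrite summxE.
case: (split_ordP r) => s ->; rewrite ?col_mxEu ?col_mxEd ?summxE.
  by apply: eq_bigr => i _; rewrite Xy col_mxEu.
by rewrite mxE big1 // => i _; rewrite Xy col_mxEd mxE.
Qed.

End PrefixSumLayer.

(** * Stack machine of the bounded-depth Dyck language *)

Section StackMachine.
Variables (k D : nat).
Notation token := 'I_(2 * k).

Lemma bracket_type_subproof (a : token) : (a./2 < k)%N.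
Proof. by rewrite ltn_half_double -mul2n. Qed.
Definition bracket_type (a : token) : 'I_k := Ordinal (bracket_type_subproof a).

Lemma bracket_type_open (t : 'I_k) : bracket_type (open_br t) = t.
Proof. by apply: val_inj; rewrite /= mul2n doubleK. Qed.

Lemma bracket_type_close (t : 'I_k) : bracket_type (close_br t) = t.
Proof. by apply: val_inj; rewrite /= mul2n uphalf_double. Qed.

Lemma odd_open_br (t : 'I_k) : odd (open_br t) = false.
Proof. by rewrite /= mul2n odd_double. Qed.

Lemma odd_close_br (t : 'I_k) : odd (close_br t).
Proof. by rewrite /= mul2n odd_double. Qed.

Lemma open_brK (a : token) : ~~ odd a -> open_br (bracket_type a) = a.
Proof. by move=> e; apply: val_inj; rewrite /= mul2n even_halfK. Qed.

Lemma close_brK (a : token) : odd a -> close_br (bracket_type a) = a.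
Proof. by move=> e; apply: val_inj; rewrite /= mul2n odd_halfK //; case: (val a) e. Qed.

Lemma big_tokens (R : nmodType) (h : token -> R) :
  \sum_a h a = \sum_t (h (open_br t) + h (close_br t)).
Proof.
rewrite (bigID (fun a : token => odd a)) /= addrC big_split /=; congr (_ + _).
  rewrite (reindex_onto (@open_br k) bracket_type); last exact: open_brK.
  by apply: eq_bigl => t; rewrite odd_open_br bracket_type_open eqxx.
rewrite (reindex_onto (@close_br k) bracket_type); last exact: close_brK.
by apply: eq_bigl => t; rewrite odd_close_br bracket_type_close eqxx.
Qed.

(** The head of the list is the innermost open bracket. [None] is a dead state, reached by an
    unmatched closing bracket or by exceeding depth [D]. *)
Definition step (s : option (seq 'I_k)) (a : token) : option (seq 'I_k) :=
  match s with
  | None => None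
  | Some s =>
    if odd a then
      if s is t :: s' then if t == bracket_type a then Some s' else None
      else None
    else if (size s < D)%N then Some (bracket_type a :: s) else None
  end.

Definition run (w : seq token) : option (seq 'I_k) := foldl step (Some [::]) w.

Lemma run_rcons (w : seq token) (a : token) : run (rcons w a) = step (run w) a.
Proof. by rewrite /run foldl_rcons. Qed.

Lemma foldl_step_None w : foldl step None w = None.
Proof. by elim: w. Qed.

Lemma run_catl w v : run (w ++ v) -> run w.
Proof.
by rewrite /run foldl_cat; case: (foldl _ _ w) => //; rewrite foldl_step_None.
Qed.

Lemma run_take i w : run w -> run (take i w).
Proof. by move=> h; apply: (@run_catl _ (drop i w)); rewrite cat_take_drop. Qed.

Lemma depth_cat (w v : seq token) : depth (w ++ v) = depth w + depth v :> int.
Proof. by rewrite /depth !count_cat !PoszD; ring. Qed.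

Lemma depth_rcons (w : seq token) a :
  depth (rcons w a) = depth w + (if odd a then -1 else 1) :> int.
Proof.
rewrite -cats1 depth_cat; congr (_ + _).
by rewrite /depth /= /is_open /is_closed; case: (odd a).
Qed.

Lemma run_depth w s : run w = Some s -> depth w = size s /\ (size s <= D)%N.
Proof.
elim/last_ind: w s => [|w a IH] s; first by case=> <-.
rewrite run_rcons; case e: (run w) => [s0|] //= ; have [dw sD] := IH _ e.
rewrite depth_rcons dw; case: (odd a).
  case: s0 e dw sD => // t s1 e dw sD.
  by case: eqP => // _ [<-]; split; [rewrite /=; lia | apply: ltnW].
by case: ltnP => // h [<-]; split=> //=; lia.
Qed.

(** This provides the suffix that completes an accepted prefix to a Dyck word. *)
Lemma foldl_step_closes w s :
  run w = Some s -> run (w ++ map (@close_br k) s) = Some [::].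
Proof.
elim: s w => [|t s IH] w h; first by rewrite cats0.
rewrite /= -cat_rcons; apply: IH.
by rewrite run_rcons h /= mul2n odd_double bracket_type_close eqxx.
Qed.

(* [unmatched s w]: the unmatched brackets of w are the open brackets of the
   types listed in s, last one first. *)
Inductive unmatched : seq 'I_k -> seq token -> Prop :=
| unmatched_nil u : balanced u -> unmatched [::] u
| unmatched_cons t s w u : unmatched s w -> balanced u ->
    unmatched (t :: s) (w ++ open_br t :: u).

Lemma unmatched_cat s w v : unmatched s w -> balanced v -> unmatched s (w ++ v).
Proof.
case=> [u bu|t s0 w0 u h bu] bv; first by constructor; apply: balanced_cat.
by rewrite -catA cat_cons; constructor=> //; apply: balanced_cat.
Qed.

(** On the empty stack this yields balance. A closing bracket wraps the balanced word after the last
    unmatched bracket, and the result is appended to the part before that bracket. *)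
Lemma run_unmatched w s : run w = Some s -> unmatched s w.
Proof.
elim/last_ind: w s => [|w a IH] s; first by case=> <-; do 2!constructor.
rewrite run_rcons; case e: (run w) => [s0|] //=; have := IH _ e; move=> {e IH}.
case: ifP => [oa|/negbT/open_brK oa].
  case=> [//|t s1 w1 u h bu]; case: eqP => // -> [<-].
  rewrite -cats1 -catA; apply: unmatched_cat => //=.
  by rewrite cats1 -{2}(close_brK oa); apply: balanced_wrap.
move=> h; case: ltnP => // _ [<-]; rewrite -cats1 -{2}oa.
by constructor=> //; constructor.
Qed.

Lemma balanced_depth (w : seq token) : balanced w -> depth w = 0 :> int.
Proof.
elim=> [//|t u _ IH|u v _ IHu _ IHv]; last by rewrite depth_cat IHu IHv.
rewrite -cat1s depth_cat depth_rcons IH odd_close_br.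
by rewrite -[[:: _]]/(rcons [::] _) depth_rcons odd_open_br.
Qed.

(** An arbitrary initial stack lets the induction enter a wrapped word; the depth allowance shrinks
    by [size s]. *)
Lemma foldl_step_balanced w s : balanced w ->
  (forall x y, w = x ++ y -> (size s)%:Z + depth x <= D%:Z :> int) ->
  foldl step (Some s) w = Some s.
Proof.
move=> bw; elim: bw s => [//|t u bu IH|u v bu IHu bv IHv] s hw; last first.
  rewrite foldl_cat IHu ?IHv // => x y e.
    by have := hw (u ++ x) y; rewrite e depth_cat balanced_depth // add0r catA; apply.
  by apply: (hw x (y ++ v)); rewrite e catA.
rewrite -cat1s foldl_cat /= odd_open_br bracket_type_open.
have sD : (size s < D)%N.
  have := hw [:: open_br t] _ erefl.
  by rewrite -[[:: _]]/(rcons [::] _) depth_rcons odd_open_br /depth /=; lia.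
rewrite sD -cats1 foldl_cat IH /= ?mul2n ?odd_double /= ?bracket_type_close ?eqxx //.
move=> x y e; have := hw (open_br t :: x) (rcons y (close_br t)).
rewrite e -rcons_cat => /(_ erefl).
rewrite -(cat1s (open_br t)) -[[:: _]]/(rcons [::] _) depth_cat depth_rcons odd_open_br.
by rewrite /= /depth /=; lia.
Qed.

Lemma Dyck_prefixP N (w : N.-tuple token) : Dyck_prefix D w <-> run w.
Proof.
split=> [[v [bv dv]]|].
  apply: (@run_catl _ v); rewrite /run foldl_step_balanced // => x y e.
  by rewrite add0r; have := dv (size x); rewrite e take_size_cat.
case e: (run w) => [s|//] _; have rwv := foldl_step_closes e.
exists (map (@close_br k) s); split.
  by have := run_unmatched rwv => h; inversion h.
move=> i; have : run (take i (w ++ map (@close_br k) s)) by rewrite run_take ?rwv.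
case e': (run _) => [s'|//] _; have [-> h] := run_depth e'.
by rewrite lez_nat.
Qed.

End StackMachine.

(** * Next-token law *)

Section NextToken.
Variables (R : realType) (k D : nat) (q : R).
Hypotheses (hk : (1 <= k)%N) (hD : (1 <= D)%N) (hq0 : 0 < q) (hq1 : q < 1).
Notation token := 'I_(2 * k).
Notation step := (@step k D).
Notation run := (@run k D).

(** [size s] is the depth before the token, whereas the weights test the depth after it: depth [1]
    after an opening becomes [size s == 0], and depth below [D - 1] after a closing becomes
    [size s < D]. *)
Definition next_prob (s : seq 'I_k) (a : token) : R :=
  if odd a then
    if s is t :: _ then
      if t == bracket_type a then (if (size s < D)%N then 1 - q else 1) else 0
    else 0
  else if size s == 0 then 1 / k%:R
  else if (size s < D)%N then q / k%:R else 0.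

Lemma sum_next_prob s : (size s <= D)%N -> \sum_a next_prob s a = 1.
Proof.
move=> sD; have k0 : k%:R != 0 :> R by rewrite pnatr_eq0 -lt0n.
rewrite big_tokens big_split /next_prob /=.
under eq_bigr => t _ do rewrite mul2n odd_double.
under [X in _ + X]eq_bigr => t _.
  rewrite mul2n odd_double /= bracket_type_close; over.
rewrite sumr_const card_ord; case: s sD => [|t s] sD /=.
  by rewrite big1 // addr0 -[_ *+ k]mulr_natr divfK.
rewrite (bigD1 t) //= eqxx big1 => [|t' ne]; last by rewrite eq_sym (negbTE ne).
case: ifP => _; rewrite -[_ *+ k]mulr_natr ?divfK ?mul0r ?addr0 ?add0r //.
by rewrite addrC subrK.
Qed.

Lemma next_prob_gt0 s a : step (Some s) a -> 0 < next_prob s a.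
Proof.
have k0 : 0 < k%:R :> R by rewrite ltr0n.
rewrite /= /next_prob; case: ifP => _.
  by case: s => // t s; case: eqP => // _ _; case: ifP => _ //; rewrite subr_gt0.
by case: ifP => // sD _; case: ifP => _; rewrite divr_gt0.
Qed.

Lemma next_prob_eq0 s a : ~~ step (Some s) a -> next_prob s a = 0.
Proof.
rewrite /= /next_prob; case: ifP => _; first by case: s => // t s; case: eqP.
(* Here [1 <= D] matters: it lets the empty stack accept every open bracket. *)
by case: ifP => // sD _; case: eqP => // s0; move: sD; rewrite s0 hD.
Qed.

(** Writing the weight as a product over positions lets the last factor split off when a token is
    appended. *)
Let token_weight (a : token) (d : int) : R :=
  (if is_open a && (d == 1) then 1 / k%:R else 1)
  * (if is_open a && (1 < d) then q / k%:R else 1)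
  * (if is_closed a && (d < D%:Z - 1) then 1 - q else 1).

Let weight (w : seq token) : R :=
  \prod_(i < size w)
    token_weight (nth (open_br (Ordinal hk)) w i) (depth (take i.+1 w)).

Let prefix_weight (w : seq token) : R := if run w then weight w else 0.

Let Dyck_weightE N (w : N.-tuple token) : Dyck_weight q D w = weight w.
Proof.
rewrite /weight -(big_mkord xpredT (fun i =>
  token_weight (nth (open_br (Ordinal hk)) w i) (depth (take i.+1 w)))).
rewrite size_tuple big_mkord /token_weight !big_split /Dyck_weight /=.
have powE (P : pred 'I_N) (r : R) :
    r ^+ #|[set i : 'I_N | P i]| = \prod_(i < N) (if P i then r else 1).
  by rewrite -prodr_const -big_mkcond; apply: eq_bigl => i; rewrite inE.
by rewrite !powE; congr (_ * _ * _); apply: eq_bigr => i _;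
  rewrite (tnth_nth (open_br (Ordinal hk))).
Qed.

(** The new factor is [next_prob]; if [a] is rejected, both sides vanish. *)
Let prefix_weight_rcons w s a :
  run w = Some s -> prefix_weight (rcons w a) = weight w * next_prob s a.
Proof.
move=> e; rewrite /prefix_weight run_rcons e.
case st: (step (Some s) a) => [s'|]; last by rewrite next_prob_eq0 ?st ?mulr0.
have [dw sD] := run_depth e.
rewrite /weight size_rcons big_ord_recr /= nth_rcons ltnn eqxx.
congr (_ * _).
  apply: eq_bigr => i _; rewrite nth_rcons ltn_ord; congr (token_weight _ (depth _)).
  by rewrite -cats1 takel_cat.
rewrite take_oversize ?size_rcons // depth_rcons dw.
move: st; rewrite /= /token_weight /next_prob /is_open /is_closed.
case: (odd a) => /=.
  case: s e dw sD => // t s e dw sD; case: eqP => // _ _; rewrite !mul1r /=.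
  have -> : ((size s).+1%:Z - 1 < D%:Z - 1) = ((size s).+1 < D)%N by lia.
  by [].
case: ifP => // sD' _; rewrite mulr1.
have -> : ((size s)%:Z + 1 == 1) = (size s == 0)%N by lia.
have -> : (1 < (size s)%:Z + 1) = (size s != 0)%N by lia.
by case: eqP => _ /=; rewrite ?mulr1 ?mul1r.
Qed.

Let weight_gt0 w : run w -> 0 < weight w.
Proof.
elim/last_ind: w => [|w a IH] h; first by rewrite /weight big_ord0 ltr01.
have hw : run w by move: h; rewrite -cats1; apply: run_catl.
case e: (run w) => [s|]; last by rewrite e in hw.
have <- : prefix_weight (rcons w a) = weight (rcons w a) by rewrite /prefix_weight h.
rewrite (prefix_weight_rcons a e) mulr_gt0 ?IH // next_prob_gt0 //.
by move: h; rewrite run_rcons e.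
Qed.

Let sum_prefix_weight_rcons w : \sum_a prefix_weight (rcons w a) = prefix_weight w.
Proof.
case e: (run w) => [s|].
  under eq_bigr => a _ do rewrite (prefix_weight_rcons a e).
  have [_ sD] := run_depth e.
  by rewrite -mulr_sumr sum_next_prob // mulr1 /prefix_weight e.
rewrite /prefix_weight e big1 // => a _.
by rewrite run_rcons e.
Qed.

(** Induction on the number of missing tokens, since appending one token conserves the total
    weight. *)
Let sum_extensions N (w : seq token) : (size w <= N)%N ->
  \sum_(x : N.-tuple token | prefix w x) prefix_weight x = prefix_weight w.
Proof.
move=> wN; have [m mE] : exists m, m = (N - size w)%N by eexists.
elim: m w wN mE => [|m IH] w wN mE.
  have sw : size w == N by lia.
  rewrite (big_pred1 (Tuple sw)) // => x.
  apply/idP/eqP => [|->]; last exact: prefix_refl.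
  case/prefixP => v e; apply: val_inj; rewrite /= e.
  have := size_tuple x; rewrite e size_cat => h.
  rewrite (_ : v = [::]) ?cats0 //; apply/nilP.
  by rewrite /nilp -(eqn_add2l (size w)) h addn0 eq_sym.
rewrite -sum_prefix_weight_rcons.
transitivity (\sum_a \sum_(x : N.-tuple token | prefix (rcons w a) x) prefix_weight x);
  last by apply: eq_bigr => a _; apply: IH; rewrite size_rcons; lia.
rewrite [RHS](exchange_big_dep (fun x : N.-tuple token => prefix w x)) /=; last first.
  by move=> a x _; apply: prefix_trans; apply: prefix_rcons.
(* A word [x] longer than its prefix [w] extends exactly one [rcons w a], so the inner sum has one
   term. *)
apply: eq_bigr => x /prefixP[v e].
have : size v != 0.
  apply/eqP => v0; have := size_tuple x; rewrite e size_cat v0 => h; lia.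
case: v e => // b v e _; rewrite (big_pred1 b) // => a /=.
by rewrite e -cats1 prefix_catr // prefix_cons prefix0s eqxx andbT.
Qed.

(** The normalizing constant is [1], as the total weight of all extensions of the empty word. *)
Let Dyck_pmfE N (w : N.-tuple token) : Dyck_pmf q D w = prefix_weight w.
Proof.
have validE (v : N.-tuple token) : `[< Dyck_prefix D v >] = run v :> bool.
  by apply/asboolP/idP => /Dyck_prefixP.
have sum1 : \sum_(v : N.-tuple token | `[< Dyck_prefix D v >]) Dyck_weight q D v = 1.
  transitivity (\sum_(x : N.-tuple token | prefix [::] x) prefix_weight x).
    rewrite [RHS](eq_bigl xpredT) => [|x]; last exact: prefix0s.
    rewrite big_mkcond; apply: eq_bigr => v _.
    by rewrite validE /prefix_weight Dyck_weightE.
  by rewrite sum_extensions // /prefix_weight /= /weight big_ord0.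
by rewrite /Dyck_pmf sum1 divr1 validE /prefix_weight Dyck_weightE.
Qed.

(** Both probabilities are prefix weights, and their quotient no longer involves [N]. *)
Lemma next_token_probE N (w : seq token) s : (size w < N)%N -> run w = Some s ->
  next_token_prob q D N w = \col_a next_prob s a.
Proof.
move=> wN e; apply/colP => a; rewrite !mxE /Dyck_prob.
have probE u : (size u <= N)%N ->
    \sum_(x : N.-tuple token | prefix u x) Dyck_pmf q D x = prefix_weight u.
  by move=> uN; rewrite -(sum_extensions uN); apply: eq_bigr => x _; exact: Dyck_pmfE.
rewrite !probE ?size_rcons //; last exact: ltnW.
rewrite (prefix_weight_rcons a e) /prefix_weight e mulrAC divff ?mul1r //.
by rewrite gt_eqF // weight_gt0 // e.
Qed.

End NextToken.

(** * Vector codes of tokens and stacks *)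

Section StackEncoding.
Variables (k D : nat) (V : zmodType) (base : V) (vec : 'I_k -> nat -> V).
Notation token := 'I_(2 * k).

(* [vec t i] encodes an open bracket of type t at level i of the stack; None is
   the starting token, and s is the stack after reading the token. *)
Definition token_code (a : option token) (s : seq 'I_k) : V :=
  match a with
  | None => base
  | Some a => if odd a then - vec (bracket_type a) (size s)
              else vec (bracket_type a) (size s).-1
  end.

Fixpoint stack_code (s : seq 'I_k) : V :=
  if s is t :: s' then stack_code s' + vec t (size s') else base.

(** A closing bracket leaves a stack whose size is the level of its partner, so the two codes
    cancel. *)
Lemma stack_code_step s a s' : step D (Some s) a = Some s' ->
  stack_code s' = stack_code s + token_code (Some a) s'.
Proof.
rewrite /=; case: ifP => _.
  by case: s => // t s; case: eqP => // <- [<-]; rewrite /= addrK.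
by case: ifP => // _ [<-].
Qed.

Definition stack (w : seq token) : seq 'I_k := odflt [::] (run D w).

(** [stack_code_step] telescopes, starting from the code [base] of the starting token. *)
Lemma sum_token_code (w : seq token) : run D w ->
  base + \sum_(i < size w) token_code (onth w i) (stack (take i.+1 w)) =
  stack_code (stack w).
Proof.
elim/last_ind: w => [|w a IH] h; first by rewrite big_ord0 addr0.
have hw : run D w by move: h; rewrite -cats1; apply: run_catl.
rewrite size_rcons big_ord_recr /= addrA take_oversize ?size_rcons //.
have -> : onth (rcons w a) (size w) = Some a by rewrite -cats1 onth_cat ltnn subnn.
have -> : base + \sum_(i < size w) token_code (onth (rcons w a) i)
    (stack (take i.+1 (rcons w a))) = stack_code (stack w).
  rewrite -IH //; congr (_ + _); apply: eq_bigr => i _.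
  by rewrite -cats1 onth_cat ltn_ord takel_cat.
rewrite /stack; move: h; rewrite run_rcons.
case e: (run D w) => [s|//]; case e': (step _ _ _) => [s'|//] _.
by rewrite (stack_code_step e').
Qed.

End StackEncoding.

(** * Concrete vector codes and their injectivity *)

Section Channels.
Variables (R : realType) (k D : nat).
Notation token := 'I_(2 * k).

(* Channel None marks the starting token; the channels of tokens carry the
   bracket types in layer 1 and the output of layer 2; the channels (t, i)
   carry the stack. *)
Definition channel : Type := option (token + 'I_k * 'I_D).

Definition channel_vec (f : channel -> R) : 'cV[R]_#|{: channel}| :=
  \col_j f (enum_val j).

Lemma channel_vecE f x : channel_vec f (enum_rank x) 0 = f x.
Proof. by rewrite mxE enum_rankK. Qed.

Definition start_vec := channel_vec (fun x => (x == None)%:R).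

(** Layer 1 sees tokens without their levels, hence a code constant in [i]; the shape shared with
    [level_vec] lets [stack_code] serve both layers. *)
Definition type_vec (t : 'I_k) (i : nat) :=
  channel_vec (fun x => (x == Some (inl (open_br t)))%:R).

Definition level_vec (t : 'I_k) (i : nat) :=
  channel_vec (fun x => if x is Some (inr (t', i')) then
                        ((t == t') && (i == i'))%:R else 0).

(** Provides the hypothesis [u_o] of [prefix_sum_layer] at the start channel. *)
Lemma start_channel_stack_code (v : 'I_k -> nat -> 'cV[R]_#|{: channel}|) (s : seq 'I_k) :
  (forall t i, v t i (enum_rank None) 0 = 0) ->
  stack_code start_vec v s (enum_rank None) 0 = 1.
Proof.
by move=> v0; elim: s => [|t s IH] /=; rewrite ?channel_vecE // mxE IH v0 addr0.
Qed.

(** The start channel separates the starting token from the brackets; a bracket is identified by its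
    type channel and the sign there. *)
Lemma type_code_inj a a' s s' :
  token_code start_vec type_vec a s = token_code start_vec type_vec a' s' -> a = a'.
Proof.
have codeE b r t : token_code start_vec type_vec (Some b) r
    (enum_rank (Some (inl (open_br t)))) 0 =
    (if odd b then -1 else 1) * (bracket_type b == t)%:R.
  rewrite /=; have E i : type_vec (bracket_type b) i
      (enum_rank (Some (inl (open_br t)))) 0 = (bracket_type b == t)%:R.
    rewrite channel_vecE; congr (_%:R); congr nat_of_bool.
    by apply/eqP/eqP => [[e]|-> //]; apply: val_inj => /=; lia.
  by case: ifP => _; [rewrite mxE E mulN1r | rewrite E mul1r].
have sgn_neq : (-1 == 1 :> R) = false 
  by rewrite lt_eqF // (lt_trans (ltrN10 R)).
have code0 b r : token_code start_vec type_vec (Some b) r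
    (enum_rank None) 0 = 0.
  rewrite /=; case: ifP => _; last by rewrite channel_vecE.
  by rewrite mxE channel_vecE oppr0.
have start1 r : token_code start_vec type_vec None r (enum_rank None) 0 = 1.
  by rewrite channel_vecE.
move=> e; have e' x : token_code start_vec type_vec a s x 0 =
  token_code start_vec type_vec a' s' x 0 by rewrite e.
case: a a' e' {e} => [b|] [b'|] // e'; last 2 first.
- by have := e' (enum_rank None); rewrite code0 start1 => /esym/eqP; rewrite oner_eq0.
- by have := e' (enum_rank None); rewrite code0 start1 => /eqP; rewrite oner_eq0.
congr Some; have := e' (enum_rank (Some (inl (open_br (bracket_type b))))).
rewrite !codeE eqxx mulr1; case: eqP => [et|_]; last first.
  by rewrite mulr0; case: ifP => _ /eqP; rewrite ?oppr_eq0 oner_eq0.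
rewrite mulr1; case: ifPn => ob; case: ifPn => ob' /eqP;
  rewrite ?[1 == -1]eq_sym ?sgn_neq // => _.
  by rewrite -(close_brK ob) -(close_brK ob') et.
by rewrite -(open_brK ob) -(open_brK ob') et.
Qed.

(** Summing all coordinates gives [1] for the starting token and [1] for each bracket on the
    stack. *)
Lemma stack_code_size (v : 'I_k -> nat -> 'cV[R]_#|{: channel}|) (s s' : seq 'I_k) :
  (forall t i, (i < D)%N -> \sum_x v t i x 0 = 1) ->
  (size s <= D)%N -> (size s' <= D)%N ->
  stack_code start_vec v s = stack_code start_vec v s' -> size s = size s'.
Proof.
move=> v1.
have sumE r : (size r <= D)%N -> \sum_x stack_code start_vec v r x 0 = (size r).+1%:R.
  elim: r => [|t r IH] /= rD.
    rewrite (bigD1 (enum_rank None)) //= channel_vecE big1 ?addr0 // => x.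
    by rewrite -(inj_eq (@enum_val_inj _ _)) enum_rankK mxE => /negbTE ->.
  under eq_bigr => x _ do rewrite mxE.
  by rewrite big_split /= IH ?v1 ?natr1 // ltnW.
move=> sD s'D e; have := sumE s sD.
by rewrite e sumE // => /eqP; rewrite eqr_nat => /eqP[].
Qed.

Lemma sum_type_vec t i : \sum_x type_vec t i x 0 = 1.
Proof.
rewrite (bigD1 (enum_rank (Some (inl (open_br t))))) //= channel_vecE eqxx.
rewrite big1 ?addr0 // => x.
by rewrite -(inj_eq (@enum_val_inj _ _)) enum_rankK mxE => /negbTE ->.
Qed.

Lemma sum_level_vec t i : (i < D)%N -> \sum_x level_vec t i x 0 = 1.
Proof.
move=> iD; rewrite (bigD1 (enum_rank (Some (inr (t, Ordinal iD))))) //=.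
rewrite channel_vecE !eqxx.
rewrite big1 ?addr0 // => x; rewrite -(inj_eq (@enum_val_inj _ _)) enum_rankK mxE.
case: (enum_val x) => [[//|[t' i']]|//] ne.
case: (t =P t') ne => //= <-; case: (i =P i') => //= ii' /eqP[].
by congr (Some (inr (_, _))); apply: val_inj.
Qed.

(** The sizes agree first, so the two top brackets sit on the same level. Lower brackets vanish on
    the channels of this level, so the types agree and the tops can be stripped off. *)
Lemma level_stack_code_inj s s' : (size s <= D)%N -> (size s' <= D)%N ->
  stack_code start_vec level_vec s = stack_code start_vec level_vec s' -> s = s'.
Proof.
have high r t (i : 'I_D) : (size r <= i)%N ->
    stack_code start_vec level_vec r (enum_rank (Some (inr (t, i)))) 0 = 0.
  elim: r => [|t' r IH] /= ri; first by rewrite channel_vecE.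
  rewrite mxE IH ?(ltnW ri) // channel_vecE add0r.
  by rewrite (ltn_eqF ri) andbF.
move=> sD s'D e; have := stack_code_size sum_level_vec sD s'D e.
elim: s s' sD {s'D} e => [|t s IH] [|t' s'] //= sD e [ss].
have : stack_code start_vec level_vec s (enum_rank (Some (inr (t, Ordinal sD)))) 0 +
    level_vec t (size s) (enum_rank (Some (inr (t, Ordinal sD)))) 0 =
    stack_code start_vec level_vec s' (enum_rank (Some (inr (t, Ordinal sD)))) 0 +
    level_vec t' (size s') (enum_rank (Some (inr (t, Ordinal sD)))) 0.
  move: e; set x := enum_rank _.
  by move/(congr1 (fun a : 'cV_#|{: channel}| => a x 0)); rewrite !mxE.
rewrite !high //=; last by rewrite ss.
rewrite !channel_vecE /= ss !eqxx andbT.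
case: eqP => [tt _|_ /eqP]; last by rewrite !add0r oner_eq0.
by subst t'; congr (_ :: _); apply: IH => //;
  [exact: ltnW | move: e; rewrite ss => /addIr].
Qed.

End Channels.

(** * Tokens and stacks along an input *)

Section Inputs.
Variables (R : realType) (k D n : nat) (w : n.-tuple 'I_(2 * k)).

(** The starting token being [ord_max], [unlift ord_max] sends it to [None]; the tokens of [w] are
    shifted by one position. *)
Lemma unlift_with_start (j : 'I_n.+1) :
  unlift ord_max (tnth (with_start w) j) = if val j is i.+1 then onth w i else None.
Proof.
case: (unliftP ord0 j) => [i|] -> /=; last by rewrite tnth0 unlift_none.
rewrite tnthS tnth_map.
have -> : widen_ord (leqnSn (2 * k)) (tnth w i) = lift ord_max (tnth w i).
  by apply: val_inj; rewrite /= /bump leqNgt ltn_ord.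
by rewrite liftK add0n onthE (nth_map (tnth w i)) ?size_tuple // -tnth_nth.
Qed.

Hypothesis run_w : run D w.

Lemma run_prefix j : run D (take j w). Proof. exact: run_take. Qed.

Lemma size_stack_prefix j : (size (stack D (take j w)) <= D)%N.
Proof.
have := run_prefix j; rewrite /stack; case e: (run D _) => [s|//] _.
by have [] := run_depth e.
Qed.

(** This is the prefix sum hypothesis of [prefix_sum_layer], for either code. Position [j] of the
    padded input is where [take j w] ends. *)
Lemma sum_prefix_code (V : zmodType) (base : V) (vec : 'I_k -> nat -> V) (j : 'I_n.+1) :
  \sum_(i < n.+1 | (i <= j)%N)
    token_code base vec (unlift ord_max (tnth (with_start w) i))
      (stack D (take i w)) =
  stack_code base vec (stack D (take j w)).
Proof.
have jn : (j <= size w)%N by rewrite size_tuple -ltnS.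
rewrite -sum_token_code ?run_prefix // size_takel //.
under eq_big => [i|i _] do [rewrite -ltnS | rewrite unlift_with_start].
rewrite -(big_ord_widen n.+1 (fun i => token_code base vec
  (if i is i'.+1 then onth w i' else None) (stack D (take i w)))) ?ltn_ord //.
rewrite big_ord_recl /=; congr (_ + _); apply: eq_bigr => i _.
congr (token_code _ _ _ (stack _ _)); last by rewrite take_takel.
by rewrite -{1}(cat_take_drop j w) onth_cat size_takel // ltn_ord.
Qed.

End Inputs.

(** * Assembly of the two layers *)

Theorem corollary1 (R : realType) (k D : nat) (q : R)
    (hk : (1 <= k)%N) (hD : (1 <= D)%N) (hq0 : 0 < q) (hq1 : q < 1) :
  exists T : transformer2 R k,
    [/\ uniform_attention (layer1 T),
        uniform_attention (layer2 T)
      & forall (n : nat) (w : n.-tuple 'I_(2 * k)), Dyck_prefix D w ->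
        forall N : nat, (n < N)%N ->
          transformer2_eval T w = next_token_prob q D N w].
Proof.
(* A state is the current token with the stack after it; bounding the stack size by [D] makes the
   states finite in number. *)
pose I := (option 'I_(2 * k) * D.-bseq 'I_k)%type.
pose start := start_vec R k D; pose tv := @type_vec R k D; pose lv := @level_vec R k D.
pose y1 (i : I) : 'cV[R]_#|{: channel k D}| := token_code start tv i.1 i.2.
pose u1 (i : I) : 'cV[R]_#|{: channel k D}| := stack_code start tv i.2.
pose y2 (i : I) : 'cV[R]_#|{: channel k D}| := token_code start lv i.1 i.2.
pose u2 (i : I) : 'cV[R]_#|{: channel k D}| := stack_code start lv i.2.
pose c := #|{: channel k D}|.
pose out (s : seq 'I_k) := channel_vec (fun x : channel k D =>
  if x is Some (inl a) then next_prob D q s a else 0).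
(* The zero lower blocks give the output of layer 1 the form that layer 2 expects as input. *)
pose z1 (i : I) : 'cV[R]_(c + (c + c)) := col_mx (y2 i) 0.
pose z2 (i : I) : 'cV[R]_(c + (c + c)) := col_mx (out i.2) 0.
have start_u1 i : u1 i (enum_rank None) 0 = 1.
  by apply: start_channel_stack_code => t l; apply: channel_vecE.
have start_u2 i : u2 i (enum_rank None) 0 = 1.
  by apply: start_channel_stack_code => t l; apply: channel_vecE.
(* The sum of layer 1 is used only for the stack size; with the token, this is all that the refined
   code [y2] depends on. *)
have det1 i i' : y1 i = y1 i' -> u1 i = u1 i' ->
    z1 i = z1 i'.
  case: i i' => [a s] [a' s'] /type_code_inj /= -> /stack_code_size => e.
  rewrite /z1 /y2 /= /token_code e ?size_bseq // => t l _; exact: sum_type_vec.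
have det2 i i' : y2 i = y2 i' -> u2 i = u2 i' ->
    z2 i = z2 i'.
  by rewrite /z2; move=> _ /level_stack_code_inj ->; rewrite ?size_bseq.
have [L1 [unif1 L1E]] := prefix_sum_layer start_u1 det1.
have [L2 [unif2 L2E]] := prefix_sum_layer start_u2 det2.
(* The code by types is the same for all stacks, so the empty one can stand for the true one. *)
pose embed a : 'cV[R]_(c + (c + c)) :=
  col_mx (token_code start tv (unlift ord_max a) [::]) 0.
pose head : 'M[R]_(2 * k, c) :=
  \matrix_(a, x) (enum_val x == Some (inl a))%:R.
exists (Transformer2 (\matrix_(i, a) embed a i 0) L1 L2 (row_mx head 0)).
split=> // n w /Dyck_prefixP rw N nN.
(* [insub_bseq] has a default for lists longer than [D], a case excluded by [size_stack_prefix]. *)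
pose idx (j : 'I_n.+1) : I :=
  (unlift ord_max (tnth (with_start w) j), insub_bseq D (stack D (take j w))).
have idxE j : (idx j).2 = stack D (take j w) :> seq _.
  by rewrite insubdK // -topredE /= size_stack_prefix.
have [s e] : exists s, run D w = Some s by case: (run D w) rw => // s; exists s.
rewrite (next_token_probE hk hD hq0 hq1 _ e) ?size_tuple //.
rewrite /transformer2_eval /= (L2E _ _ idx).
- rewrite mul_row_col mulmx0 addr0 idxE take_oversize ?size_tuple // /stack e /=.
  apply/colP => a; rewrite !mxE (bigD1 (enum_rank (Some (inl a)))) //= channel_vecE.
  rewrite mxE enum_rankK eqxx mul1r big1 ?addr0 // => x xa.
  by rewrite mxE -(inj_eq (@enum_rank_inj _)) enum_valK (negbTE xa) mul0r.
- apply: L1E => j.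
    rewrite colE -mulmxA -colE; apply/colP => r; rewrite mxE.
    rewrite (bigD1 (tnth (with_start w) j)) //= big1 ?addr0 => [|x xj].
      rewrite !mxE eqxx mulr1 /embed /y1 /=.
      by case: unlift => //= a; case: ifP.
    by rewrite !mxE (negbTE xj) mulr0.
  by rewrite /u1 idxE -sum_prefix_code.
- move=> j; rewrite /u2 idxE -sum_prefix_code //; apply: eq_bigr => i _.
  by rewrite /y2 idxE.
Qed.
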